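(* Let $A$ be an algebra in a semidegenerate congruence modular variety such that $K(A)$ is closed under the commutator, and assume the reticulation of $A$ preserves the Boolean center. Then for every $\alpha\in B(Con(A))$ the set $D_A(\alpha)$ is clopen in $Spec(A)$, and the map $B(Con(A))\rightarrow Clop(Spec(A))$, $\alpha\mapsto D_A(\alpha)$, is a Boolean isomorphism.
   Context: $\mathcal{V}$ is a congruence modular, semidegenerate variety (no nontrivial algebra has a one-element subalgebra; equivalently $\nabla_A$ is compact) of finite signature; $A\in\mathcal{V}$. $Con(A)$ is the congruence lattice with bounds $\Delta_A,\nabla_A$, $[\cdot,\cdot]$ the Freese–McKenzie commutator, $K(A)$ the compact congruences. $[\alpha,\alpha]^0=\alpha$, $[\alpha,\alpha]^{n+1}=[[\alpha,\alpha]^n,[\alpha,\alpha]^n]$. A congruence $\phi\neq\nabla_A$ is prime if $[\alpha,\beta]\subseteq\phi$ implies $\alpha\subseteq\phi$ or $\beta\subseteq\phi$; $Spec(A)$ is the set of primes; $\rho(\theta)$ is the intersection of primes containing $\theta$; $V_A(\theta)=\{\phi\in Spec(A):\theta\subseteq\phi\}$, $D_A(\theta)=Spec(A)\setminus V_A(\theta)$, and the sets $D_A(\theta)$, $\theta\in Con(A)$, are the open sets of the topology on $Spec(A)$. $Clop(X)$ is the Boolean algebra of clopen subsets of $X$. $B(Con(A))$ is the Boolean algebra of complemented elements of $Con(A)$. The reticulation $L(A)=K(A)/{\equiv}$ ($\alpha\equiv\beta$ iff $\rho(\alpha)=\rho(\beta)$) is a bounded distributive lattice with canonical map $\lambda_A:K(A)\to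 L(A)$; $\lambda_A$ maps $B(Con(A))$ injectively into the Boolean center $B(L(A))$ (complemented elements of $L(A)$). The reticulation of $A$ preserves the Boolean center if $\lambda_A|_{B(Con(A))}:B(Con(A))\to B(L(A))$ is surjective. *)

(* Defs.v *)
From Stdlib Require Import List.
From mathcomp Require Import all_boot.

Set Implicit Arguments.
Unset Strict Implicit.
Unset Printing Implicit Defensive.

Record signature := Signature {
  opsym : finType;
  arity : opsym -> nat
}.

Record algebra (S : signature) := Algebra {
  carrier :> Type;
  op : forall f : opsym S, ('I_(arity f) -> carrier) -> carrier
}.
Arguments op {S B} f _ : rename.

Inductive term (S : signature) (X : Type) : Type :=
  | Var : X -> term S X
  | App : forall f : opsym S, ('I_(arity f) -> term S X) -> term S X.
Arguments Var {S X} _.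
Arguments App {S X} f _.

Fixpoint eval (S : signature) (X : Type) (B : algebra S) (v : X -> B)
    (t : term S X) : B :=
  match t with
  | Var x => v x
  | App f ts => @op S B f (fun i => eval v (ts i))
  end.

Definition models (S : signature) (Eqs : term S nat -> term S nat -> Prop)
    (B : algebra S) : Prop :=
  forall s t, Eqs s t -> forall v : nat -> B, eval v s = eval v t.

Definition prel (T : Type) := T -> T -> Prop.

Definition subrel (T : Type) (r s : prel T) : Prop := forall x y, r x y -> s x y.
Definition releq (T : Type) (r s : prel T) : Prop := forall x y, r x y <-> s x y.

Definition is_con (S : signature) (B : algebra S) (th : prel B) : Prop :=
  (forall x, th x x) /\
  (forall x y, th x y -> th y x) /\
  (forall x y z, th x y -> th y z -> th x z) /\
  (forall (f : opsym S) (x y : 'I_(arity f) -> B),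
      (forall i, th (x i) (y i)) -> th (op f x) (op f y)).

Definition Delta (T : Type) : prel T := fun x y => x = y.
Definition Nabla (T : Type) : prel T := fun _ _ => True.
Definition meet (T : Type) (r s : prel T) : prel T := fun x y => r x y /\ s x y.

Definition bigjoin (S : signature) (B : algebra S) (P : prel B -> Prop) : prel B :=
  fun x y => forall d : prel B, is_con d -> (forall th : prel B, P th -> subrel th d) -> d x y.

Definition join (S : signature) (B : algebra S) (a b : prel B) : prel B :=
  bigjoin (fun th : prel B => th = a \/ th = b).

Definition compact (S : signature) (B : algebra S) (th : prel B) : Prop :=
  is_con th /\
  forall P : prel B -> Prop, (forall a : prel B, P a -> is_con a) ->
    subrel th (bigjoin P) ->
    exists s : list (prel B), (forall a : prel B, In a s -> P a) /\
                             subrel th (bigjoin (fun a : prel B => In a s)).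

Definition con_modular (S : signature) (B : algebra S) : Prop :=
  forall a b c : prel B, is_con a -> is_con b -> is_con c -> subrel a c ->
    releq (join a (meet b c)) (meet (join a b) c).

Definition cong_modular_variety (S : signature)
    (Eqs : term S nat -> term S nat -> Prop) : Prop :=
  forall B : algebra S, models Eqs B -> con_modular B.

Definition semidegenerate_variety (S : signature)
    (Eqs : term S nat -> term S nat -> Prop) : Prop :=
  forall B : algebra S, models Eqs B ->
    (exists x y : B, x <> y) ->
    ~ (exists b : B, forall f : opsym S, op f (fun _ => b) = b).

Definition sum_val (T : Type) (a u : nat -> T) : nat + nat -> T :=
  fun z => match z with inl k => a k | inr k => u k end.

Definition centralizes (S : signature) (B : algebra S) (al be de : prel B) : Prop :=
  forall (t : term S (nat + nat)) (a b u v : nat -> B),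
    (forall k, al (a k) (b k)) -> (forall k, be (u k) (v k)) ->
    de (eval (sum_val a u) t) (eval (sum_val a v) t) ->
    de (eval (sum_val b u) t) (eval (sum_val b v) t).

(* the commutator [alpha, beta]: least congruence delta with C(alpha,beta;delta)
   (equal to the Freese--McKenzie commutator in congruence modular varieties) *)
Definition comm (S : signature) (B : algebra S) (al be : prel B) : prel B :=
  fun x y => forall d : prel B, is_con d -> centralizes al be d -> d x y.

Definition prime_con (S : signature) (B : algebra S) (ph : prel B) : Prop :=
  is_con ph /\ ~ releq ph (@Nabla B) /\
  forall a b : prel B, is_con a -> is_con b -> subrel (comm a b) ph ->
    subrel a ph \/ subrel b ph.

Definition Spec (S : signature) (B : algebra S) := {ph : prel B | prime_con ph}.

Definition rho (S : signature) (B : algebra S) (th : prel B) : prel B :=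
  fun x y => forall p : Spec B, subrel th (sval p) -> sval p x y.

Definition sset (S : signature) (B : algebra S) := Spec B -> Prop.
Definition sseteq (S : signature) (B : algebra S) (U V : sset B) : Prop :=
  forall p, U p <-> V p.

Definition V_A (S : signature) (B : algebra S) (th : prel B) : sset B :=
  fun p => subrel th (sval p).
Definition D_A (S : signature) (B : algebra S) (th : prel B) : sset B :=
  fun p => ~ subrel th (sval p).

Definition open_spec (S : signature) (B : algebra S) (U : sset B) : Prop :=
  exists th : prel B, is_con th /\ sseteq U (D_A th).

Definition clopen_spec (S : signature) (B : algebra S) (U : sset B) : Prop :=
  open_spec U /\ open_spec (fun p => ~ U p).

Definition is_compl (S : signature) (B : algebra S) (a b : prel B) : Prop :=
  is_con b /\ releq (meet a b) (@Delta B) /\ releq (join a b) (@Nabla B).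

Definition in_BCon (S : signature) (B : algebra S) (a : prel B) : Prop :=
  is_con a /\ exists b : prel B, is_compl a b.

(* lambda(a) = lambda(b) in L(B) = K(B)/== *)
Definition lam_eq (S : signature) (B : algebra S) (a b : prel B) : Prop :=
  releq (rho a) (rho b).

(* lambda(theta) lies in the Boolean center B(L(B)), where the lattice
   operations of L(B) are lambda(a) \/ lambda(b) = lambda(a \/ b),
   lambda(a) /\ lambda(b) = lambda([a,b]), 0 = lambda(Delta), 1 = lambda(Nabla) *)
Definition lam_in_BL (S : signature) (B : algebra S) (th : prel B) : Prop :=
  exists et : prel B, compact et /\
    lam_eq (join th et) (@Nabla B) /\ lam_eq (comm th et) (@Delta B).

(* the reticulation preserves the Boolean center: lambda restricted to
   B(Con(B)) is onto B(L(B)) *)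
Definition retic_preserves_BC (S : signature) (B : algebra S) : Prop :=
  forall th : prel B, compact th -> lam_in_BL th ->
    exists a : prel B, in_BCon a /\ lam_eq a th.

(* Main.v *)
From Stdlib Require Import List.
From mathcomp Require Import all_boot.
From mathcomp Require Import boolp classical_sets.
Require Import Defs.

(**
  Two facts drive the proof. First, for a congruence [be], viewed as a subalgebra
  of [A * A], let [Sy] be the largest congruence on [be] for which [d] is a union
  of classes; then [al] centralizes [be] modulo [d] iff [Sy] identifies the
  diagonal elements over [al]-related points. Hence centralizers are closed under
  joins, and if the top congruence centralizes [be] modulo [d] then the diagonal
  is a one-element subalgebra of [be / Sy], so that [be <= d] by semidegeneracy.
  Secondly, by modularity [al] centralizes [be] modulo any [d >= al /\ be], and
  [C(c, c; d)] passes to all congruences above [d]. Together these give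
  that maximal congruences are prime.

  The top congruence is generated by the finitely many pairs [(f(b,..,b), b)],
  since [b] is a one-element subalgebra of the quotient by them. So every proper
  congruence lies below a prime, and a clopen set and its complement can be
  written as [D(g)] and [D(e)] with [g], [e] finitely generated and [g \/ e] the
  top congruence; then the class of [g] is complemented in the reticulation.
*)

Set Implicit Arguments.
Unset Strict Implicit.
Unset Printing Implicit Defensive.

(** * Terms: substitution and evaluation *)

Section Terms.
Variable S : signature.

Fixpoint tsubst (X Y : Type) (s : X -> term S Y) (t : term S X) : term S Y :=
  match t with
  | Var x => s x
  | App f ts => App f (fun i => tsubst s (ts i))
  end.

Lemma eval_tsubst (X Y : Type) (B : algebra S) (v : Y -> B)
    (s : X -> term S Y) (t : term S X) :
  eval v (tsubst s t) = eval (fun x => eval v (s x)) t.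
Proof. by elim: t => [x|f ts IH] //=; congr op; apply/funext. Qed.

Lemma eval_hom (X : Type) (B C : algebra S) (h : B -> C) (v : X -> B)
    (t : term S X) :
  (forall f x, h (op f x) = op f (fun i => h (x i))) ->
  h (eval v t) = eval (fun x => h (v x)) t.
Proof.
move=> hM; elim: t => [x|f ts IH] //=.
by rewrite hM; congr op; apply/funext.
Qed.

Lemma eval_con (X : Type) (B : algebra S) (th : prel B) (v w : X -> B)
    (t : term S X) :
  is_con th -> (forall x, th (v x) (w x)) -> th (eval v t) (eval w t).
Proof. by move=> [_ [_ [_ thop]]] vw; elim: t => [x|f ts IH] //=; apply: thop. Qed.

End Terms.

Lemma In_mem (I : eqType) (s : seq I) i : i \in s -> In i s.
Proof. by elim: s => //= j s IH; rewrite inE => /orP[/eqP->|/IH]; [left|right]. Qed.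

(** * Congruences and the modular law *)

Section Congruences.
Variables (S : signature) (B : algebra S).
Implicit Types (a b c d th : prel B).

Lemma con_refl th x : is_con th -> th x x. Proof. by case. Qed.

Lemma con_sym th x y : is_con th -> th x y -> th y x.
Proof. by case=> _ [h _]; apply: h. Qed.

Lemma con_trans th y x z : is_con th -> th x y -> th y z -> th x z.
Proof. by case=> _ [_ [h _]]; apply: h. Qed.

Lemma con_op th f x y : is_con th -> (forall i, th (x i) (y i)) ->
  th (op f x) (op f y).
Proof. by case=> _ [_ [_ h]]; apply: h. Qed.

Lemma Nabla_con : is_con (@Nabla B). Proof. by []. Qed.

Lemma meet_con a b : is_con a -> is_con b -> is_con (meet a b).
Proof.
move=> ca cb; split=> [x|]; first by split; apply: con_refl.
split=> [x y [? ?]|]; first by split; apply: con_sym.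
split=> [x y z [? ?] [? ?]|f x y xy].
  by split; apply: (@con_trans _ y).
by split; apply: con_op => // i; case: (xy i).
Qed.

Lemma inter_con (P : prel B -> Prop) :
  is_con (fun x y => forall d, is_con d -> P d -> d x y).
Proof.
split=> [x d cd _|]; first exact: con_refl.
split=> [x y xy d cd Pd|]; first by apply: con_sym => //; apply: xy.
split=> [x y z xy yz d cd Pd|f x y xy d cd Pd].
  by apply: (@con_trans _ y) => //; [apply: xy|apply: yz].
by apply: con_op => // i; apply: xy.
Qed.

Lemma bigjoin_con (P : prel B -> Prop) : is_con (bigjoin P).
Proof. exact: inter_con. Qed.

Lemma bigjoin_ub (P : prel B -> Prop) a : P a -> subrel a (bigjoin P).
Proof. by move=> Pa x y axy d _ hd; apply: hd axy. Qed.

Lemma join_con a b : is_con (join a b). Proof. exact: bigjoin_con. Qed.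

Lemma join_ubl a b : subrel a (join a b).
Proof. by apply: bigjoin_ub; left. Qed.

Lemma join_ubr a b : subrel b (join a b).
Proof. by apply: bigjoin_ub; right. Qed.

Lemma join_lub a b d : is_con d -> subrel a d -> subrel b d -> subrel (join a b) d.
Proof. by move=> cd ad bd x y; apply=> // th [->|->]. Qed.

Lemma modular_meet_join a b c d : con_modular B ->
  is_con a -> is_con b -> is_con c -> is_con d ->
  subrel a c -> subrel a d -> subrel (meet b c) d ->
  subrel (meet (join a b) c) d.
Proof.
move=> mB ca cb cc cd ac ad bcd x y h.
have /(_ x y) [_ /(_ h)] := mB a b c ca cb cc ac.
exact: join_lub.
Qed.

(** The path [x], [x'], [y'], [y] puts [(x, y)] in [join a b]. In this form the modular law is
    applied by naming the corners of a square. *)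
Lemma modular_square a b c d x x' y y' : con_modular B ->
  is_con a -> is_con b -> is_con c -> is_con d ->
  subrel a c -> subrel a d -> subrel (meet b c) d ->
  b x x' -> a x' y' -> b y' y -> c x y -> d x y.
Proof.
move=> mB ca cb cc cd ac ad bcd xx' xy' yy' xy.
apply: (modular_meet_join mB ca cb cc cd ac ad bcd); split=> //.
have cj := join_con a b.
apply: (con_trans cj (join_ubr xx')).
exact: (con_trans cj (join_ubl xy') (join_ubr yy')).
Qed.

(* The Shifting Lemma of congruence modular algebras. *)
Lemma shifting a b c x y u v : con_modular B ->
  is_con a -> is_con b -> is_con c -> subrel (meet a b) c ->
  a x y -> c x y -> b x u -> b y v -> a u v -> c u v.
Proof.
move=> mB ca cb cc abc axy cxy xu yv uv.
apply: (@modular_square (meet c a) b a c u x v y) => //.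
- exact: meet_con.
- by move=> ? ? [].
- by move=> ? ? [].
- by move=> ? ? [? ?]; apply: abc.
- exact: con_sym.
Qed.

(** * Directed unions and compactness of finitely generated congruences *)

Section DirectedUnion.
Variables (T : Type) (t0 : T) (D : T -> prel B).
Hypothesis Dcon : forall t, is_con (D t).
Hypothesis Ddir : forall s t, exists u, subrel (D s) (D u) /\ subrel (D t) (D u).

Let U : prel B := fun x y => exists t, D t x y.

Lemma directed_seq (l : seq (B * B)) :
  (forall p, In p l -> U p.1 p.2) -> exists t, forall p, In p l -> D t p.1 p.2.
Proof.
elim: l => [|q l IH] h; first by exists t0.
have [|t ht] := IH; first by move=> p pl; apply: h; right.
have [s hs] := h q (or_introl erefl).
have [u [su tu]] := Ddir s t.
by exists u => p [<-|/ht]; [apply: su|apply: tu].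
Qed.

(** With [I] an arity this makes [U] compatible with the operations; with [I] the set of operation
    symbols it gives compactness of the top congruence. *)
Lemma directed_fin (I : finType) (x y : I -> B) :
  (forall i, U (x i) (y i)) -> exists t, forall i, D t (x i) (y i).
Proof.
move=> h; have [|t ht] := @directed_seq [seq (x i, y i) | i <- enum I].
  by move=> p /in_map_iff[i [<- _]]; apply: h.
exists t => i; apply: (ht (x i, y i)); apply/in_map_iff; exists i.
by split=> //; apply: In_mem; rewrite mem_enum.
Qed.

Lemma directed_union_con : is_con U.
Proof.
split=> [x|]; first by exists t0; apply: con_refl.
split=> [x y [t xy]|]; first by exists t; apply: con_sym.
split=> [x y z [s xy] [t yz]|f x y /directed_fin[t xy]].
  have [u [su tu]] := Ddir s t.
  by exists u; apply: (@con_trans _ y) => //; [apply: su|apply: tu].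
by exists t; apply: con_op.
Qed.

End DirectedUnion.

Definition Cg (l : seq (B * B)) : prel B :=
  fun x y => forall d, is_con d -> (forall p, In p l -> d p.1 p.2) -> d x y.

Lemma Cg_con l : is_con (Cg l). Proof. exact: inter_con. Qed.

Lemma Cg_gen l p : In p l -> Cg l p.1 p.2.
Proof. by move=> pl d _; apply. Qed.

Lemma Cg_compact l : compact (Cg l).
Proof.
split=> [|P Pcon lP]; first exact: Cg_con.
(* The joins of finite subfamilies of [P] are directed and their union contains every member of [P],
   so a single one of them contains all the generators in [l]. *)
pose T := {s : list (prel B) | forall a, In a s -> P a}.
pose D (s : T) : prel B := bigjoin (fun a => In a (sval s)).
have t0 : T by exists nil.
have Dcon t : is_con (D t) by apply: bigjoin_con.
have Ddir s t : exists u, subrel (D s) (D u) /\ subrel (D t) (D u).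
  have h a : In a (sval s ++ sval t) -> P a.
    by move=> /in_app_iff[]; [apply: (svalP s)|apply: (svalP t)].
  exists (exist _ _ h); split=> x y xy d cd dh; apply: xy => // a ha.
    by apply: dh; apply/in_app_iff; left.
  by apply: dh; apply/in_app_iff; right.
have [|s hs] := directed_seq t0 Ddir (l := l).
  move=> p pl; have := lP _ _ (Cg_gen pl).
  move=> /(_ _ (directed_union_con t0 Dcon Ddir)).
  apply=> a Pa x y axy.
  have h b : In b [:: a] -> P b by case=> // <-.
  by exists (exist _ _ h); apply: bigjoin_ub axy => /=; left.
exists (sval s); split; first exact: (svalP s).
by move=> x y; apply; first exact: Dcon.
Qed.

End Congruences.

(** * The syntactic congruence of a subset *)

Section Syntactic.
Variables (S : signature) (B : algebra S).

(* The largest congruence for which [P] is a union of classes. *)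
Definition syn (P : B -> Prop) : prel B := fun p q =>
  forall (t : term S (nat + nat)) (e : nat -> B),
    P (eval (sum_val (fun _ => p) e) t) <-> P (eval (sum_val (fun _ => q) e) t).

Variable P : B -> Prop.

Lemma syn_P p q : syn P p q -> P p -> P q.
Proof. by move=> /(_ (Var (inl 0)) (fun _ => p)) []. Qed.

Lemma syn_translation f i0 (e : 'I_(arity f) -> B) p q : syn P p q ->
  syn P (op f (fun i => if i == i0 then p else e i))
        (op f (fun i => if i == i0 then q else e i)).
Proof.
move=> pq t g.
(* A context around [op f] with a hole at [i0] is again a context around the hole. The parameters
   [e] take the indices below [arity f], and those of [t] are shifted past them. *)
pose s (z : nat + nat) : term S (nat + nat) := match z with
  | inl _ => App f (fun i => if i == i0 then Var (inl 0) else Var (inr (i : nat)))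
  | inr k => Var (inr (k + arity f)) end.
pose g' k := if insub k is Some i then e i else g (k - arity f).
have E r : eval (sum_val (fun _ => r) g') (tsubst s t) =
    eval (sum_val (fun _ => op f (fun i => if i == i0 then r else e i)) g) t.
  rewrite eval_tsubst; congr (eval _ t); apply/funext => -[k|k] /=.
    congr op; apply/funext => i; case: ifP => //= _.
    by rewrite /g' valK.
  by rewrite /g' insubN -?leqNgt ?leq_addl // addnK.
by rewrite -!E; apply: pq.
Qed.

Lemma syn_con : is_con (syn P).
Proof.
split; first by move=> x t e.
split; first by move=> x y xy t e; apply: iff_sym; apply: xy.
have tr x y z : syn P x y -> syn P y z -> syn P x z.
  by move=> xy yz t e; apply: iff_trans (xy t e) (yz t e).
split=> // f x y xy.
(* The arguments are changed from [x] to [y] one at a time, each change being a translation. *)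
suff H k : k <= arity f ->
    syn P (op f x) (op f (fun i => if i < k then y i else x i)).
  have -> : op f y = op f (fun i : 'I_(arity f) => if i < arity f then y i else x i).
    by congr op; apply/funext => i; rewrite ltn_ord.
  exact: H.
elim: k => [_|k IH kn].
  by move=> t e.
apply: tr (IH (ltnW kn)) _.
pose i0 := Ordinal kn; pose e (i : 'I_(arity f)) := if i < k then y i else x i.
have -> : op f (fun i : 'I_(arity f) => if i < k then y i else x i) =
    op f (fun i => if i == i0 then x i0 else e i).
  congr op; apply/funext => i; case: eqP => // ->.
  by rewrite /= ltnn.
have -> : op f (fun i : 'I_(arity f) => if i < k.+1 then y i else x i) =
    op f (fun i => if i == i0 then y i0 else e i).
  congr op; apply/funext => i; case: eqP => [->|/eqP ni]; first by rewrite /= ltnSn.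
  have nk : i != k :> nat by [].
  by rewrite ltnS leq_eqVlt (negbTE nk).
exact: syn_translation.
Qed.

End Syntactic.

(** * Quotient algebras and semidegeneracy *)

Section Quotient.
Variables (S : signature) (B : algebra S) (th : prel B).
Hypothesis cth : is_con th.

(** Classes are predicates, so extensionality turns related elements into equal classes; operations
    go through chosen representatives. *)
Definition quot_carrier := {C : B -> Prop | exists x, C = th x}.

Definition quot_class (x : B) : quot_carrier :=
  exist _ (th x) (ex_intro _ x erefl).

Definition quot_repr (C : quot_carrier) : B := sval (cid (svalP C)).

Definition quot : algebra S :=
  @Algebra S quot_carrier (fun f x => quot_class (op f (fun i => quot_repr (x i)))).

Lemma quot_classP x y : quot_class x = quot_class y <-> th x y.
Proof.
split=> [/(congr1 sval) /= E|xy]; first by rewrite E; apply: con_refl.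
apply: eq_exist; apply/funext => z; apply/propext; split=> h.
  exact: con_trans (con_sym cth xy) h.
exact: con_trans xy h.
Qed.

Lemma quot_reprK C : quot_class (quot_repr C) = C.
Proof.
rewrite /quot_repr; case: cid => x /= E.
by case: C E => C hC /= E; apply: eq_exist.
Qed.

Lemma quot_class_op f x :
  op f (fun i => quot_class (x i) : quot) = quot_class (op f x).
Proof.
apply: (quot_classP _ _).2; apply: con_op => // i.
by apply: (quot_classP _ _).1; rewrite quot_reprK.
Qed.

Lemma quot_models (Eqs : term S nat -> term S nat -> Prop) :
  models Eqs B -> models Eqs quot.
Proof.
move=> mB s t st v.
have -> : v = fun k => quot_class (quot_repr (v k)).
  by apply/funext => k; rewrite quot_reprK.
have hom f x : quot_class (op f x) = op f (fun i => quot_class (x i) : quot).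
  by rewrite quot_class_op.
by rewrite -!(@eval_hom S nat B quot quot_class _ _ hom) (mB s t st).
Qed.

End Quotient.

Lemma semidegenerate_con_Nabla (S : signature)
    (Eqs : term S nat -> term S nat -> Prop) (B : algebra S) (th : prel B) (b : B) :
  semidegenerate_variety Eqs -> models Eqs B -> is_con th ->
  (forall f, th (op f (fun _ => b)) b) -> forall x y, th x y.
Proof.
move=> sd mB cth hb x y; apply: contrapT => nxy.
apply: (sd (quot th) (quot_models cth mB)).
  by exists (quot_class th x), (quot_class th y) => /(quot_classP cth).
exists (quot_class th b) => f.
by rewrite (quot_class_op cth); apply/quot_classP.
Qed.

(** * A congruence as an algebra of pairs, and the term condition *)

Section PairAlgebra.
Variables (S : signature) (A : algebra S) (be : prel A).
Hypothesis cbe : is_con be.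

Definition pair_carrier := {p : A * A | be p.1 p.2}.

Lemma pair_op_subproof f (x : 'I_(arity f) -> pair_carrier) :
  be (op f (fun i => (sval (x i)).1)) (op f (fun i => (sval (x i)).2)).
Proof. by apply: con_op => // i; case: (x i). Qed.

(* The congruence [be] as a subalgebra of [A * A]. *)
Definition pair_alg : algebra S :=
  @Algebra S pair_carrier (fun f x => exist _ (_, _) (pair_op_subproof x)).

Definition mkpair x y (h : be x y) : pair_alg := exist _ (x, y) h.
Definition diag x : pair_alg := mkpair (con_refl x cbe).

Lemma pair_alg_eq (p q : pair_alg) :
  (sval p).1 = (sval q).1 -> (sval p).2 = (sval q).2 -> p = q.
Proof.
case: p => [[p1 p2] hp]; case: q => [[q1 q2] hq] /= E1 E2.
by apply: eq_exist; rewrite E1 E2.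
Qed.

Lemma eval_pair_fst (X : Type) (v : X -> pair_alg) (t : term S X) :
  (sval (eval v t)).1 = eval (fun x => (sval (v x)).1) t.
Proof. exact: (@eval_hom S X pair_alg A (fun p => (sval p).1)). Qed.

Lemma eval_pair_snd (X : Type) (v : X -> pair_alg) (t : term S X) :
  (sval (eval v t)).2 = eval (fun x => (sval (v x)).2) t.
Proof. exact: (@eval_hom S X pair_alg A (fun p => (sval p).2)). Qed.

Lemma pair_models (Eqs : term S nat -> term S nat -> Prop) :
  models Eqs A -> models Eqs pair_alg.
Proof.
move=> mA s t st v; apply: pair_alg_eq; rewrite ?eval_pair_fst ?eval_pair_snd.
  exact: mA.
exact: mA.
Qed.

Lemma diag_op f x : diag (op f x) = op f (fun i => diag (x i)).
Proof. exact: pair_alg_eq. Qed.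

Variable d : prel A.

Definition syn_pair : prel pair_alg := syn (fun p : pair_alg => d (sval p).1 (sval p).2).

Lemma syn_pair_con : is_con syn_pair. Proof. exact: syn_con. Qed.

(* This turns the term condition, a statement on tuples, into a statement on
   single pairs. *)
Lemma centralizesP (al : prel A) : is_con al ->
  centralizes al be d <-> forall x z, al x z -> syn_pair (diag x) (diag z).
Proof.
move=> cal; split=> [C x z xz t e|h t a b u v ab uv].
  have E (w : A) : ((sval (eval (sum_val (fun _ => diag w) e) t)).1 =
      eval (sum_val (fun _ => w) (fun k => (sval (e k)).1)) t) /\
      ((sval (eval (sum_val (fun _ => diag w) e) t)).2 =
      eval (sum_val (fun _ => w) (fun k => (sval (e k)).2)) t).
    by rewrite eval_pair_fst eval_pair_snd; split; congr eval;
      apply/funext => -[].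
  have [-> ->] := E x; have [-> ->] := E z.
  have ebe k : be (sval (e k)).1 (sval (e k)).2 by exact: (svalP (e k)).
  (* The converse implication is the term condition for the reversed pair [(z, x)]. *)
  split; apply: C => // _; exact: con_sym.
pose e k := mkpair (uv k).
have ev (w : nat -> A) :
    ((sval (eval (sum_val (fun k => diag (w k)) e) t)).1 = eval (sum_val w u) t) /\
    ((sval (eval (sum_val (fun k => diag (w k)) e) t)).2 = eval (sum_val w v) t).
  by rewrite eval_pair_fst eval_pair_snd; split; congr eval;
    apply/funext => -[].
have := @eval_con S _ pair_alg syn_pair (sum_val (fun k => diag (a k)) e)
  (sum_val (fun k => diag (b k)) e) t syn_pair_con.
have [E1 E2] := ev a; have [F1 F2] := ev b.
move=> /(_ _)/syn_P; rewrite E1 E2 F1 F2; apply.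
by case=> k /=; [apply: h|apply: con_refl; apply: syn_pair_con].
Qed.

(** Since [diag] is a homomorphism, pulling [syn_pair] back along it gives a congruence of [A]; it
    contains [a] and [b], hence their join. *)
Lemma centralizes_join (a b : prel A) : is_con a -> is_con b ->
  centralizes a be d -> centralizes b be d -> centralizes (join a b) be d.
Proof.
move=> ca cb /(centralizesP ca) ha /(centralizesP cb) hb.
apply/centralizesP; first exact: join_con.
apply: join_lub => //.
have cs := syn_pair_con.
split=> [x|]; first exact: con_refl.
split=> [x y|]; first exact: con_sym.
split=> [x y z|f x y xy]; first exact: con_trans.
by rewrite !diag_op; apply: con_op.
Qed.

(* The diagonal is a one-element subalgebra of [pair_alg] modulo [syn_pair]. *)
Lemma semidegenerate_centralizes (Eqs : term S nat -> term S nat -> Prop) :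
  semidegenerate_variety Eqs -> models Eqs A -> is_con d ->
  centralizes (@Nabla A) be d -> subrel be d.
Proof.
move=> sd mA cd /(centralizesP (Nabla_con A)) h x y xy.
have := @semidegenerate_con_Nabla S Eqs pair_alg syn_pair (diag x) sd
  (pair_models mA) syn_pair_con.
move=> /(_ _ (diag x) (mkpair xy)) H.
apply: (syn_P (H _)) => [f|]; last exact: con_refl.
by rewrite -diag_op; apply: h.
Qed.

End PairAlgebra.

(** * The commutator, maximal congruences and primes *)

Section Commutator.
Variables (S : signature) (A : algebra S).
Implicit Types (a b c d p : prel A).

Lemma comm_con a b : is_con (comm a b). Proof. exact: inter_con. Qed.

Lemma centralizes_comm a b : centralizes a b (comm a b).
Proof.
move=> t x y u v xy uv h d cd C; apply: (C t x y u v xy uv).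
exact: h.
Qed.

Lemma centralizes_mono a a' b b' d : subrel a a' -> subrel b b' ->
  centralizes a' b' d -> centralizes a b d.
Proof. by move=> aa bb C t x y u v xy uv; apply: C => k; [apply: aa|apply: bb]. Qed.

(** The values of [t] at [(y,u)], [(x,u)], [(x,v)], [(y,v)] are the corners of a modular square: two
    opposite sides lie in [a], the other two in [b], and one of the latter is in [d] by
    hypothesis. *)
Lemma centralizes_of_meet a b d : con_modular A ->
  is_con a -> is_con b -> is_con d -> subrel (meet a b) d -> centralizes a b d.
Proof.
move=> mA ca cb cd abd t x y u v xy uv h.
have bb z : b (eval (sum_val z u) t) (eval (sum_val z v) t).
  by apply: eval_con => // -[k|k] /=; [apply: con_refl|].
have aa z : a (eval (sum_val x z) t) (eval (sum_val y z) t).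
  by apply: eval_con => // -[k|k] /=; [|apply: con_refl].
apply: (@modular_square _ _ (meet d b) a b d _ (eval (sum_val x u) t) _
  (eval (sum_val x v) t)) => //.
- exact: meet_con.
- by move=> ? ? [].
- by move=> ? ? [].
- exact: con_sym.
Qed.

Lemma comm_sub_meet a b : con_modular A -> is_con a -> is_con b ->
  subrel (comm a b) (meet a b).
Proof.
move=> mA ca cb x y; apply; first exact: meet_con.
by apply: centralizes_of_meet => //; apply: meet_con.
Qed.

(* In [Con(c)], with [h0] and [h1] the kernels of the projections and [m0] the
   restriction of [p] to the fibres of [h0], shifting gives
   [syn_pair /\ h0 <= m0], whence [(syn_pair \/ m0) /\ h0 <= m0] by modularity. *)
Lemma centralizes_self_up (Eqs : term S nat -> term S nat -> Prop) c d p :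
  cong_modular_variety Eqs -> models Eqs A ->
  is_con c -> is_con d -> is_con p -> subrel d p ->
  centralizes c c d -> centralizes c c p.
Proof.
move=> cm mA cc cd cp dp C t a b u v ab uv.
have mB : con_modular (pair_alg cc) by apply: cm; apply: pair_models.
have hdiag := (centralizesP cc d cc).1 C.
pose B := pair_alg cc.
pose h0 : prel B := fun P Q => (sval P).1 = (sval Q).1.
pose h1 : prel B := fun P Q => (sval P).2 = (sval Q).2.
pose m0 : prel B := fun P Q => (sval P).1 = (sval Q).1 /\ p (sval P).2 (sval Q).2.
have ch0 : is_con h0.
  split=> //; split=> [x y|]; first by rewrite /h0 => ->.
  split=> [x y z|f x y xy]; first by rewrite /h0 => -> ->.
  by rewrite /h0 /=; congr op; apply/funext.
have ch1 : is_con h1.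
  split=> //; split=> [x y|]; first by rewrite /h1 => ->.
  split=> [x y z|f x y xy]; first by rewrite /h1 => -> ->.
  by rewrite /h1 /=; congr op; apply/funext.
have cm0 : is_con m0.
  have cp2 : is_con (fun P Q : B => p (sval P).2 (sval Q).2).
    split=> [x|]; first exact: con_refl.
    split=> [x y|]; first exact: con_sym.
    split=> [x y z|f x y xy]; first exact: con_trans.
    by apply: con_op.
  exact: (meet_con ch0 cp2).
pose sy := @syn_pair _ _ _ cc d.
have csy : is_con sy by apply: syn_pair_con.
have sh0 : subrel (meet sy h0) m0.
  move=> P Q [PQ E]; split=> //.
  case: P Q PQ E => [[x y] /= xy] [[x' w] /= xw'] PQ; rewrite /h0 /= => E.
  subst x'.
  have wy : c w y by apply: (con_trans cc (con_sym cc xw') xy).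
  have : sy (diag cc w) (mkpair cc wy).
    (* Moving [(x,w)] and [(x,y)] along [h1] to first coordinate [w] makes one of them diagonal, so
       saturation of [d] yields [d w y]. *)
    apply: (shifting mB ch0 ch1 csy _ _ (con_sym csy PQ)) => //.
    move=> P Q [E0 E1]; have -> : P = Q by apply: pair_alg_eq.
    exact: con_refl.
  move=> /syn_P/(_ (con_refl w cd))/dp.
  exact: con_sym.
move=> h.
have uv_con w : c (eval (sum_val w u) t) (eval (sum_val w v) t).
  by apply: eval_con => // -[k|k] /=; [apply: con_refl|].
have xz : c (eval (sum_val a u) t) (eval (sum_val b u) t).
  by apply: eval_con => // -[k|k] /=; [|apply: con_refl].
pose P := mkpair cc (uv_con a); pose Q := mkpair cc (uv_con b).
have PQ : sy P Q.
  pose e k := mkpair cc (uv k).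
  have E w : mkpair cc (uv_con w) = eval (sum_val (fun k => diag cc (w k)) e) t.
    by apply: pair_alg_eq; rewrite ?eval_pair_fst ?eval_pair_snd /=; congr eval;
      apply/funext => -[].
  rewrite /P /Q !E; apply: eval_con => // -[k|k] /=; first exact: hdiag.
  exact: con_refl.
pose x := eval (sum_val a u) t; pose z := eval (sum_val b u) t.
(* The square has corners [diag z], [diag x], [P], [Q]. Its side [m0 (diag x) P] is the hypothesis
   [h], and the opposite side is the goal. *)
have : m0 (diag cc z) Q.
  apply: (@modular_square _ _ m0 sy h0 m0 _ (diag cc x) _ P) => //.
  - by move=> ? ? [].
  - by apply: hdiag; apply: con_sym.
by case.
Qed.

Lemma maximal_prime (Eqs : term S nat -> term S nat -> Prop) p :
  cong_modular_variety Eqs -> semidegenerate_variety Eqs -> models Eqs A ->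
  is_con p -> ~ releq p (@Nabla A) ->
  (forall q, is_con q -> subrel p q -> ~ subrel q p -> forall x y, q x y) ->
  prime_con p.
Proof.
move=> cm sd mA cp pN pmax; split=> //; split=> // a b ca cb abp.
have mCA := cm A mA.
(* By maximality [join e p] is the top congruence; it centralizes [c] modulo [p] because [e] and [p]
   both do. *)
have key e c : is_con e -> is_con c -> ~ subrel e p -> centralizes e c p ->
    subrel c p.
  move=> ce cc nep C; apply: (semidegenerate_centralizes cc sd mA cp).
  have jN x y : join e p x y.
    apply: (pmax (join e p)); [exact: join_con|exact: join_ubr|].
    by move=> h; apply: nep => u v /(@join_ubl _ _ e p)/h.
  apply: (centralizes_mono (a' := join e p) (b' := c)) => //.
  apply: centralizes_join => //.
  by apply: centralizes_of_meet => // ? ? [].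
apply: contrapT => /not_orP[nap nbp].
have cab := meet_con ca cb.
have nabp : ~ subrel (meet a b) p.
  move=> h; apply: nbp; apply: (key a b) => //.
  exact: centralizes_of_meet.
(* [meet a b] centralizes itself modulo [comm a b], hence modulo the larger [p], so [key] applies to
   it twice over. *)
apply: (nabp); apply: (key (meet a b)) => //.
apply: (centralizes_self_up cm mA cab (comm_con a b) cp abp).
by apply: centralizes_mono (centralizes_comm (a := a) (b := b)) => ? ? [].
Qed.

(** Some [D t] contains the finitely many pairs [(f(b,..,b), b)], and these force it to be the top
    congruence. *)
Lemma directed_union_Nabla (Eqs : term S nat -> term S nat -> Prop)
    (T : Type) (t0 : T) (D : T -> prel A) :
  semidegenerate_variety Eqs -> models Eqs A ->
  (forall t, is_con (D t)) ->
  (forall s t, exists u, subrel (D s) (D u) /\ subrel (D t) (D u)) ->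
  (forall x y, exists t, D t x y) -> exists t, forall x y, D t x y.
Proof.
move=> sd mA Dcon Ddir DN.
(* The carrier may be empty; then any index works. *)
have [[b _]|nb] := pselect (exists b : A, True); last first.
  by exists t0 => x; case: nb; exists x.
have [|t ht] := directed_fin t0 Ddir (x := fun f => op f (fun _ => b))
  (y := fun _ => b); first by move=> f; apply: DN.
by exists t; apply: (semidegenerate_con_Nabla sd mA (Dcon t) ht).
Qed.

Lemma prime_above (Eqs : term S nat -> term S nat -> Prop) th :
  cong_modular_variety Eqs -> semidegenerate_variety Eqs -> models Eqs A ->
  is_con th -> ~ (forall x y, th x y) -> exists p : Spec A, subrel th (sval p).
Proof.
move=> cm sd mA cth thN.
(* Zorn is applied to the sets [W] such that [W \/ th] is a proper congruence,
   so that the empty chain needs no separate treatment. *)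
pose rel (W : set (A * A)) : prel A := fun x y => W (x, y) \/ th x y.
pose P (W : set (A * A)) := is_con (rel W) /\ ~ (forall x y, rel W x y).
have P0 : P set0.
  have E : rel set0 = th.
    by apply/funext => x; apply/funext => y; apply/propext; split=> [[]|] //; right.
  by rewrite /P E.
have [|W [[cW WN] Wmax]] := @Zorn_bigcup _ P.
  move=> F FP Ftot.
  pose T := {W : set (A * A) | F W \/ W = set0}.
  pose D (W : T) := rel (sval W).
  have PT (W : T) : P (sval W) by case: W => W /= [/FP|->].
  have t0 : T by exists set0; right.
  have Dcon t : is_con (D t) by case: (PT t).
  have Ddir s t : exists u, subrel (D s) (D u) /\ subrel (D t) (D u).
    case: s => X [FX|X0]; last first.
      by exists t; split=> // x y [] /=; [rewrite X0|right].
    case: t => Y [FY|Y0]; last first.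
      exists (exist _ X (or_introl FX)); split=> // x y [] /=; first by rewrite Y0.
      by right.
    have [XY|YX] := Ftot X Y FX FY.
      exists (exist _ Y (or_introl FY)); split=> // x y [/XY|]; [left|right] => //.
    exists (exist _ X (or_introl FX)); split=> // x y [/YX|]; [left|right] => //.
  have E : rel (\bigcup_(X in F) X)%classic = fun x y => exists t, D t x y.
    apply/funext => x; apply/funext => y; apply/propext; split.
      case=> [[X FX Xxy]|h]; last by exists t0; right.
      by exists (exist _ X (or_introl FX)); left.
    case=> -[X hX] [/= Xxy|h]; last by right.
    by case: hX Xxy => [FX Xxy|-> //]; left; exists X.
  rewrite /P E; split; first exact: directed_union_con.
  (* If the union of the chain were the top congruence, a member already would be. *)
  move=> /(directed_union_Nabla t0 sd mA Dcon Ddir)[t].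
  by case: (PT t).
have pp : prime_con (rel W).
  apply: (maximal_prime cm sd mA) => // [h|q cq Wq qW].
    by apply: WN => x y; apply/(h x y).
  apply: contrapT => qN.
  pose Q : set (A * A) := fun z => q z.1 z.2.
  have E : rel Q = q.
    apply/funext => x; apply/funext => y; apply/propext; split; last by left.
    by case=> // h; apply: Wq; right.
  apply: (Wmax Q); last by rewrite /P E.
  split; first by move=> [x y] Wxy; apply: Wq; left.
  by move=> QW; apply: qW => x y qxy; left; apply: QW.
by exists (exist _ _ pp) => x y; right.
Qed.

End Commutator.

(** * Open sets of the spectrum and the Boolean isomorphism *)

Section Spectrum.
Variables (S : signature) (A : algebra S).
Implicit Types (a b : prel A) (p : Spec A).

Lemma Spec_con p : is_con (sval p). Proof. by case: (svalP p). Qed.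

Lemma D_A_Nabla p : D_A (@Nabla A) p.
Proof.
case: (svalP p) => _ [pN _] h; apply: pN => x y.
by split=> // _; apply: h.
Qed.

Lemma D_A_join a b : sseteq (D_A (join a b)) (fun p => D_A a p \/ D_A b p).
Proof.
move=> p; split=> [h|].
  apply: contrapT => /not_orP[/contrapT ap /contrapT bp].
  by apply: h; apply: join_lub => //; apply: Spec_con.
by case=> h jp; apply: h => x y xy; apply: jp; [apply: join_ubl|apply: join_ubr].
Qed.

Lemma D_A_meet a b : con_modular A -> is_con a -> is_con b ->
  sseteq (D_A (meet a b)) (fun p => D_A a p /\ D_A b p).
Proof.
move=> mA ca cb p; split=> [h|[ha hb] abp].
  by split=> h'; apply: h => x y [xa xb]; apply: h'.
case: (svalP p) => _ [_ /(_ a b ca cb)[|//|//]].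
by move=> x y /(comm_sub_meet mA ca cb)/abp.
Qed.

Lemma D_A_compl a b : con_modular A -> is_con a -> is_compl a b ->
  sseteq (D_A b) (fun p => ~ D_A a p).
Proof.
move=> mA ca [cb [abD abN]] p; split=> [hb ha|/contrapT ha hb].
  apply: ((D_A_meet mA ca cb p).2 (conj ha hb)) => x y /abD ->.
  by apply: con_refl; apply: Spec_con.
apply: (@D_A_Nabla p) => x y /abN.
by apply: join_lub => //; apply: Spec_con.
Qed.

Lemma join_Nabla (Eqs : term S nat -> term S nat -> Prop) a b :
  cong_modular_variety Eqs -> semidegenerate_variety Eqs -> models Eqs A ->
  (forall p, D_A a p \/ D_A b p) -> forall x y, join a b x y.
Proof.
move=> cm sd mA h; apply: contrapT.
move=> /(prime_above cm sd mA (join_con a b))[p jp].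
exact: (D_A_join a b p).2 (h p) jp.
Qed.

(* If [a'] is a complement of [a] then [b \/ a'] is the top congruence, and both
   [b] and [a'] centralize [a] modulo [b]. *)
Lemma D_A_le (Eqs : term S nat -> term S nat -> Prop) a a' b :
  cong_modular_variety Eqs -> semidegenerate_variety Eqs -> models Eqs A ->
  is_con a -> is_con b -> is_compl a a' ->
  (forall p, D_A a p -> D_A b p) -> subrel a b.
Proof.
move=> cm sd mA ca cb aa' ab; have mCA := cm A mA.
have [ca' [aD _]] := aa'.
apply: (semidegenerate_centralizes ca sd mA cb).
have jN : forall x y, join b a' x y.
  apply: (join_Nabla cm sd mA) => p.
  have [/ab|na] := pselect (D_A a p); first by left.
  by right; apply/(D_A_compl mCA ca aa').
apply: (centralizes_mono (a' := join b a') (b' := a)) => //.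
apply: centralizes_join => //; apply: centralizes_of_meet => //.
  by move=> ? ? [].
by move=> x y [? ?]; have /aD -> : meet a a' x y by []; apply: con_refl.
Qed.

(** The joins [Cg l \/ Cg m], for finite lists of pairs from [a] and from [b], form a directed
    family whose union is the top congruence, so one of them is the top. *)
Lemma join_Nabla_Cg (Eqs : term S nat -> term S nat -> Prop) a b :
  semidegenerate_variety Eqs -> models Eqs A -> is_con a -> is_con b ->
  (forall x y, join a b x y) ->
  exists l m, [/\ subrel (Cg l) a, subrel (Cg m) b
                & forall x y, join (Cg l) (Cg m) x y].
Proof.
move=> sd mA ca cb jN.
pose L (c : prel A) := {l : seq (A * A) | forall z, In z l -> c z.1 z.2}.
have catL c (l m : L c) z : In z (sval l ++ sval m) -> c z.1 z.2.
  by move=> /in_app_iff[]; [apply: (svalP l)|apply: (svalP m)].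
pose D (lm : L a * L b) := join (Cg (sval lm.1)) (Cg (sval lm.2)).
have Cgl l m : subrel (@Cg S A l) (Cg (l ++ m)).
  by move=> x y h d cd dz; apply: h => // z zl; apply: dz; apply/in_app_iff; left.
have Cgr l m : subrel (@Cg S A m) (Cg (l ++ m)).
  by move=> x y h d cd dz; apply: h => // z zl; apply: dz; apply/in_app_iff; right.
have nilL c : L c by exists nil.
have Dcon t : is_con (D t) by apply: join_con.
have Ddir s t : exists u, subrel (D s) (D u) /\ subrel (D t) (D u).
  exists (exist _ _ (@catL a s.1 t.1), exist _ _ (@catL b s.2 t.2)).
  split; apply: join_lub; rewrite /D /=; try exact: join_con.
  - by move=> x y /(@Cgl _ (sval t.1)); apply: join_ubl.
  - by move=> x y /(@Cgl _ (sval t.2)); apply: join_ubr.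
  - by move=> x y /(@Cgr (sval s.1)); apply: join_ubl.
  - by move=> x y /(@Cgr (sval s.2)); apply: join_ubr.
have [|[l m] /= lm] := directed_union_Nabla (nilL a, nilL b) sd mA Dcon Ddir.
  have cU := directed_union_con (nilL a, nilL b) Dcon Ddir.
  move=> x y; apply: (join_lub cU) (jN x y) => {}x {}y xy.
    have h z : In z [:: (x, y)] -> a z.1 z.2 by case=> // <-.
    exists (exist _ _ h, nilL b); apply: join_ubl => /=.
    by apply: (Cg_gen (p := (x, y))); left.
  have h z : In z [:: (x, y)] -> b z.1 z.2 by case=> // <-.
  exists (nilL a, exist _ _ h); apply: join_ubr => /=.
  by apply: (Cg_gen (p := (x, y))); left.
exists (sval l), (sval m); split=> // x y; apply=> //.
  exact: (svalP l).
exact: (svalP m).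
Qed.

Lemma lam_eq_D_A a b : lam_eq a b -> sseteq (D_A a) (D_A b).
Proof.
move=> E p; split=> h h'; apply: h => x y xy.
  by have /E : rho a x y by [move=> q; apply]; apply.
by have /E : rho b x y by [move=> q; apply]; apply.
Qed.

Lemma clopen_surj (Eqs : term S nat -> term S nat -> Prop) :
  cong_modular_variety Eqs -> semidegenerate_variety Eqs -> models Eqs A ->
  retic_preserves_BC A -> forall U : sset A, clopen_spec U ->
  exists a, in_BCon a /\ sseteq (D_A a) U.
Proof.
move=> cm sd mA bc U [[th [cth Uth]] [th' [cth' Uth']]].
have mCA := cm A mA.
have /(join_Nabla_Cg sd mA cth cth')[l [m [lth mth jN]]] : forall x y, join th th' x y.
  apply: (join_Nabla cm sd mA) => p.
  by have [/Uth|/Uth'] := pselect (U p); [left|right].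
have Dl p : D_A (Cg l) p -> U p by move=> h; apply/Uth => h'; apply: h => x y /lth/h'.
have Dm p : D_A (Cg m) p -> ~ U p.
  by move=> h; apply/Uth' => h'; apply: h => x y /mth/h'.
(* The sets of [Cg l] and [Cg m] lie in [U] and in its complement and together cover the spectrum,
   so both inclusions are equalities. *)
have UE : sseteq (D_A (Cg l)) U.
  move=> p; split; first exact: Dl.
  move=> Up; have : D_A (join (Cg l) (Cg m)) p.
    by move=> h; apply: (@D_A_Nabla p) => x y _; apply: h.
  by move=> /D_A_join[//|/Dm].
have [|a [ba al]] := bc (Cg l) (Cg_compact l).
  exists (Cg m); split; first exact: Cg_compact.
  split=> x y; split=> h p hp; apply: h.
  - by move=> ? ? _; apply: hp.
  - by move=> ? ? _; apply: hp.
  (* No prime lies in both open sets, so each prime contains [Cg l] or [Cg m], hence their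
     commutator. *)
  - move=> u v /(comm_sub_meet mCA (Cg_con l) (Cg_con m))[lu mv].
    have [/Dm nU|/contrapT] := pselect (D_A (Cg m) p); last by apply.
    have /contrapT : ~ D_A (Cg l) p by move=> /Dl.
    exact.
  - by move=> u v ->; apply: con_refl; apply: Spec_con.
exists a; split=> // p.
exact: iff_trans (lam_eq_D_A al p) (UE p).
Qed.

End Spectrum.

Theorem theorem4p9 (S : signature) (Eqs : term S nat -> term S nat -> Prop)
  (A : algebra S)
  (HA : models Eqs A)
  (HCM : cong_modular_variety Eqs)
  (HSD : semidegenerate_variety Eqs)
  (HK : forall a b : prel A, compact a -> compact b -> compact (comm a b))
  (HBC : retic_preserves_BC A) :
  (* D_A(alpha) is clopen for every alpha in B(Con(A)) *)
  (forall a : prel A, in_BCon a -> clopen_spec (D_A a)) /\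
  (* alpha |-> D_A(alpha) is a Boolean isomorphism B(Con(A)) -> Clop(Spec(A)) *)
  (* injective *)
  (forall a b : prel A, in_BCon a -> in_BCon b ->
     sseteq (D_A a) (D_A b) -> releq a b) /\
  (* surjective *)
  (forall U : sset A, clopen_spec U ->
     exists a : prel A, in_BCon a /\ sseteq (D_A a) U) /\
  (* preserves the bounds *)
  sseteq (D_A (@Delta A)) (fun _ => False) /\
  sseteq (D_A (@Nabla A)) (fun _ => True) /\
  (* preserves meets and joins *)
  (forall a b : prel A, in_BCon a -> in_BCon b ->
     sseteq (D_A (meet a b)) (fun p => D_A a p /\ D_A b p)) /\
  (forall a b : prel A, in_BCon a -> in_BCon b ->
     sseteq (D_A (join a b)) (fun p => D_A a p \/ D_A b p)) /\
  (* preserves complements *)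
  (forall a b : prel A, in_BCon a -> is_compl a b ->
     sseteq (D_A b) (fun p => ~ D_A a p)).
Proof.
have mA := HCM A HA.
have compl := D_A_compl mA.
split=> [a [ca [b ab]]|].
  split; first by exists a.
  exists b; split; first by case: ab.
  by move=> p; apply: iff_sym; apply: (compl a b).
split=> [a b [ca [a' aa']] [cb [b' bb']] E x y|].
  by split; [apply: (D_A_le HCM HSD HA ca cb aa')|apply: (D_A_le HCM HSD HA cb ca bb')];
    move=> p /E.
split; first exact: (clopen_surj HCM HSD HA HBC).
split.
  move=> p; split=> // h; apply: h => x y ->.
  by apply: con_refl; case: (svalP p).
split; first by move=> p; split=> // _; apply: D_A_Nabla.
split=> [a b [ca _] [cb _]|]; first exact: D_A_meet.
split=> [a b _ _|a b [ca _] ab]; first exact: D_A_join.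
exact: compl.
Qed.
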